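(* Let $\gamma\in(0,2)$ and let $\Psi_\gamma(\xi,\eta)$ be the Fourier kernel of the sesquilinear carré du champ of the $\gamma$-stable generator $L_\gamma=-(-\Delta)^{\gamma/2}$. For all $\xi,\eta\in\mathbb{R}$ with $\xi\eta\ge0$, $$\Psi_\gamma(\xi,\eta)=\tfrac12\bigl(|\xi|^\gamma+|\eta|^\gamma-|\xi-\eta|^\gamma\bigr)=R_{\gamma/2}(|\xi|,|\eta|),$$ where $R_H(s,t)=\tfrac12(|s|^{2H}+|t|^{2H}-|s-t|^{2H})$ is the covariance of fractional Brownian motion with Hurst parameter $H$. For $\xi,\eta\in\mathbb{R}$ with $\xi\eta<0$, $\Psi_\gamma(\xi,\eta)=\tfrac12(|\xi|^\gamma+|\eta|^\gamma-|\xi-\eta|^\gamma)$ differs from $R_{\gamma/2}(|\xi|,|\eta|)=\tfrac12\bigl(|\xi|^\gamma+|\eta|^\gamma-\bigl||\xi|-|\eta|\bigr|^\gamma\bigr)$.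
   Context: Let $\nu_\gamma(dz)=c_\gamma|z|^{-1-\gamma}dz$ on $\mathbb{R}\setminus\{0\}$, with $c_\gamma>0$ normalized so that $|\xi|^\gamma=\int_{\mathbb{R}\setminus\{0\}}(1-\cos\xi z)\,\nu_\gamma(dz)$ for all $\xi$. The sesquilinear carré du champ of $L_\gamma$ is $$\Gamma_\gamma(f,g)(x)=\tfrac12\int_{\mathbb{R}\setminus\{0\}}[f(x+z)-f(x)]\,\overline{[g(x+z)-g(x)]}\,\nu_\gamma(dz),$$ and $\Psi_\gamma(\xi,\eta)$ is defined by $\Gamma_\gamma(e^{i\xi\cdot},e^{i\eta\cdot})(x)=e^{i(\xi-\eta)x}\,\Psi_\gamma(\xi,\eta)$. *)

(* Defs.v *)
From HB Require Import structures.
From mathcomp Require Import all_boot all_order all_algebra.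
From mathcomp Require Import complex.
From mathcomp Require Import all_classical all_reals all_analysis.
From mathcomp Require Import measurable_realfun.

Set Implicit Arguments.
Unset Strict Implicit.
Unset Printing Implicit Defensive.

Import Order.TTheory GRing.Theory Num.Theory.
Import numFieldNormedType.Exports.

Local Open Scope classical_set_scope.
Local Open Scope ring_scope.
Local Open Scope complex_scope.

Section stable_measure.
Context {R : realType}.
Variables (gamma : R) (c : {posnum R}).

(* c |z|^(-1-gamma) dz on R \ {0}, extended to R by giving {0} mass 0. *)
Definition stable_measure (A : set R) : \bar R :=
  (\int[lebesgue_measure]_(z in A `\ 0%R)
     (c%:num * `|z| `^ (- 1 - gamma))%:E)%E.

Let density_ge0 (z : R) : (0 <= (c%:num * `|z| `^ (- 1 - gamma))%:E)%E.
Proof. by rewrite lee_fin mulr_ge0// powR_ge0. Qed.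

Let measurable_density : measurable_fun [set: R]
  (EFin \o (fun z : R => c%:num * `|z| `^ (- 1 - gamma))).
Proof.
apply/measurable_EFinP; apply: measurable_funM; first exact: measurable_cst.
by apply: (measurableT_comp (measurable_powR _)); exact: normr_measurable.
Qed.

Let stable_measure0 : stable_measure set0 = 0%E.
Proof. by rewrite /stable_measure set0D integral_set0. Qed.

Let stable_measure_ge0 A : (0 <= stable_measure A)%E.
Proof. by apply: integral_ge0 => z _; exact: density_ge0. Qed.

Let stable_measure_sigma_additive : semi_sigma_additive stable_measure.
Proof.
move=> F mF tF mUF; rewrite /stable_measure setD_bigcupl.
have mFD i : measurable (F i `\ (0 : R)) by exact: measurableD.
rewrite ge0_integral_bigcup//=.
- by apply: is_cvg_ereal_nneg_natsum_cond => n _ _; exact: integral_ge0.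
- exact: measurable_funTS.
- by apply/trivIsetP => i j _ _ ij; move/trivIsetP : tF => /(_ i j I I ij);
    rewrite !setDE setIACA => ->; rewrite set0I.
Qed.

HB.instance Definition _ := isMeasure.Build _ _ _ stable_measure
  stable_measure0 stable_measure_ge0 stable_measure_sigma_additive.

Definition stable_normalized : Prop := forall xi : R,
  (`|xi| `^ gamma)%:E =
  (\int[stable_measure]_(z in ~` [set 0%R]) (1 - cos (xi * z))%:E)%E.

End stable_measure.

(* Lebesgue integral of a complex-valued function; meaningful when the real and
   imaginary parts are integrable, Rintegral being a junk value otherwise. *)
Definition cintegral d (T : measurableType d) (R : realType)
    (mu : {measure set T -> \bar R}) (D : set T) (f : T -> R[i]) : R[i] :=
  (\int[mu]_(x in D) complex.Re (f x)) +i* (\int[mu]_(x in D) complex.Im (f x)).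

(* Sesquilinear carré du champ of L_gamma = -(-Delta)^(gamma/2). *)
Definition carre_du_champ (R : realType) (gamma : R) (c : {posnum R})
    (f g : R -> R[i]) (x : R) : R[i] :=
  (2^-1 : R)%:C * cintegral (stable_measure gamma c) (~` [set 0])
    (fun z => (f (x + z) - f x) * (g (x + z) - g x)^*).

(* x |-> e^(i xi x) *)
Definition cexpi (R : realType) (xi x : R) : R[i] :=
  cos (xi * x) +i* sin (xi * x).

(* The complex number w such that
   Gamma(e^(i xi .), e^(i eta .))(x) = e^(i (xi - eta) x) w for all x:
   xget picks an element of the set, or 0 if the set is empty. The element is
   unique, as x = 0 shows; that it exists is not assumed. *)
Definition fourier_kernel (R : realType) (gamma : R) (c : {posnum R})
    (xi eta : R) : R[i] :=
  xget 0 [set w | forall x : R,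
    carre_du_champ gamma c (cexpi xi) (cexpi eta) x = cexpi (xi - eta) x * w].

Definition fbm_cov (R : realType) (H s t : R) : R :=
  2^-1 * (`|s| `^ (2 * H) + `|t| `^ (2 * H) - `|s - t| `^ (2 * H)).

(* Main.v *)
Require Import Defs.
From mathcomp Require Import all_boot all_order all_algebra.
From mathcomp Require Import complex.
From mathcomp Require Import all_classical all_reals all_analysis.
From mathcomp Require Import measurable_realfun ring lra.

Import Order.TTheory GRing.Theory Num.Theory.
Import numFieldNormedType.Exports.

Local Open Scope ring_scope.
Local Open Scope complex_scope.

(** The increment of e^(i xi .) at x factors as e^(i xi x) (e^(i xi z) - 1), so
    the integrand of the carre du champ of e^(i xi .) and e^(i eta .) at x is
    e^(i (xi - eta) x) times
      K(z) = (e^(i xi z) - 1) (e^(- i eta z) - 1),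
    which does not depend on x. As the integral is C-linear, the Fourier kernel
    exists and equals one half of int K (fourier_kernelE).

    Expanding the product, the real part of K is
      (1 - cos xi z) + (1 - cos eta z) - (1 - cos ((xi - eta) z)),
    whose integral is given by the normalization of nu_gamma at the three
    frequencies xi, eta and xi - eta. The imaginary part is an odd function of
    z; it is dominated by (1 - cos xi z) + (1 - cos eta z), because
    |K| <= (|e^(i xi z) - 1|^2 + |e^(i eta z) - 1|^2) / 2, hence it is
    integrable, and it integrates to 0 because nu_gamma is symmetric
    (stable_measureN, Rintegral_odd). So the formula for the kernel holds
    whatever the sign of xi eta.

    Comparing with the covariance of fractional Brownian motion amounts to
    comparing |xi - eta| with ||xi| - |eta||: they are equal if xi eta >= 0,
    while |xi - eta| = |xi| + |eta| is strictly larger if xi eta < 0, and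
    t |-> t^gamma is strictly increasing on [0, +oo[. *)

(** * Symmetric measures and odd integrands *)

Lemma stable_measureN (R : realType) (gamma : R) (c : {posnum R}) (A : set R) :
  measurable A ->
  stable_measure gamma c (-%R @^-1` A)%classic = stable_measure gamma c A.
Proof.
move=> mA; rewrite /stable_measure.
have mAD : measurable (A `\ (0 : R))%classic by exact: measurableD.
have mdens : measurable_fun [set: R]%classic
    (EFin \o (fun z : R => c%:num * `|z| `^ (- 1 - gamma))).
  apply/measurable_EFinP; apply: measurable_funM; first exact: measurable_cst.
  by apply: (measurableT_comp (measurable_powR _)); exact: normr_measurable.
have -> : ((-%R @^-1` A) `\ (0 : R) =
    (-%R : _ -> measurableTypeR R) @^-1` (A `\ (0 : R)))%classic.
  by apply/seteqP; split => z /= [Az z0]; split => // /eqP;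
    rewrite ?oppr_eq0 => /eqP // z0'; apply: z0; rewrite z0' oppr0.
(* The density is even, so nu_gamma inherits the reflection invariance of the
   Lebesgue measure. *)
under eq_integral do rewrite -normrN.
transitivity (\int[pushforward lebesgue_measure
    (-%R : R -> measurableTypeR R)]_(z in A `\ (0 : R)%R)
    (c%:num * `|z| `^ (- 1 - gamma))%R%:E)%E.
  symmetry; apply: ge0_integral_pushforward => //.
  exact: measurable_funTS.
by apply: eq_measure_integral => B mB _; exact: lebesgue_measureN.
Qed.

(** The reflection z |-> - z preserves mu and D and changes the sign of f, so
    the integral is its own opposite. *)
Lemma Rintegral_odd (R : realType) (mu : {measure set R -> \bar R}) (D : set R)
    (f : R -> R) :
  (forall A : set R, measurable A -> mu (-%R @^-1` A)%classic = mu A) ->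
  measurable D -> (-%R @^-1` D)%classic = D ->
  measurable_fun [set: R]%classic f -> mu.-integrable D (EFin \o f) ->
  (forall z, f (- z) = - f z) ->
  \int[mu]_(z in D) f z = 0.
Proof.
move=> muN mD DN mf intf fN.
suff H : \int[mu]_(z in D) f z = - \int[mu]_(z in D) f z by lra.
rewrite -mulN1r -RintegralZl// /Rintegral; congr fine.
under [RHS]eq_integral do rewrite mulN1r -fN.
transitivity (\int[pushforward mu (-%R : R -> R)]_(z in D) (f z)%:E)%E.
  by apply: eq_measure_integral => B mB _; rewrite /= /pushforward muN.
rewrite -[in RHS]DN; apply: integral_pushforward => //.
  exact/measurable_EFinP.
rewrite DN; apply: eq_integrable (integrableN intf) => // z _ /=.
by rewrite fN.
Qed.

(** * Integration of complex-valued functions *)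

Lemma cintegralZl d (T : measurableType d) (R : realType)
    (mu : {measure set T -> \bar R}) (D : set T) (w : R[i]) (f : T -> R[i]) :
  measurable D ->
  mu.-integrable D (EFin \o (fun z => complex.Re (f z))) ->
  mu.-integrable D (EFin \o (fun z => complex.Im (f z))) ->
  cintegral mu D (fun z => w * f z) = w * cintegral mu D f.
Proof.
move=> mD iRe iIm; case: w => a b; rewrite /cintegral.
have iZ r (g : T -> R) : mu.-integrable D (EFin \o g) ->
    mu.-integrable D (EFin \o (fun z => r * g z)).
  by move=> ig; apply: eq_integrable (integrableZl mD r ig).
under eq_Rintegral => z _.
  have -> : complex.Re ((a +i* b) * f z) =
    a * complex.Re (f z) - b * complex.Im (f z) by case: (f z).
  over.
under [X in _ +i* X]eq_Rintegral => z _.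
  have -> : complex.Im ((a +i* b) * f z) =
    a * complex.Im (f z) + b * complex.Re (f z) by case: (f z).
  over.
rewrite RintegralB ?RintegralD ?RintegralZl//; exact: iZ.
Qed.

(** * The integrand of the carre du champ of two exponentials *)

Lemma cexpiD (R : realType) (xi x z : R) :
  cexpi xi (x + z) = cexpi xi x * cexpi xi z.
Proof.
rewrite /cexpi mulrDr cosD sinD; apply/eqP.
by rewrite eq_complex /= eqxx addrC eqxx.
Qed.

Lemma cexpiB (R : realType) (xi eta x : R) :
  cexpi (xi - eta) x = cexpi xi x * (cexpi eta x)^*.
Proof.
rewrite /cexpi mulrBl cosB sinB; apply/eqP; rewrite eq_complex /=.
by apply/andP; split; apply/eqP; ring.
Qed.

Lemma Re_cexpi_incr (R : realType) (xi eta z : R) :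
  complex.Re ((cexpi xi z - 1) * (cexpi eta z - 1)^*) =
  (1 - cos (xi * z)) + (1 - cos (eta * z)) - (1 - cos ((xi - eta) * z)).
Proof. by rewrite (mulrBl _ xi) cosB /cexpi /=; ring. Qed.

Lemma Im_cexpi_incr (R : realType) (xi eta z : R) :
  complex.Im ((cexpi xi z - 1) * (cexpi eta z - 1)^*) =
  sin ((xi - eta) * z) - sin (xi * z) + sin (eta * z).
Proof. by rewrite (mulrBl _ xi) sinB /cexpi /=; ring. Qed.

(** This is |Im (u v)| <= (|u|^2 + |v|^2) / 2 for u = e^(i a) - 1 and
    v = e^(- i b) - 1, since |e^(i a) - 1|^2 = 2 (1 - cos a). *)
Lemma sin_incr_le (R : realType) (a b : R) :
  `|sin (a - b) - sin a + sin b| <= (1 - cos a) + (1 - cos b).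
Proof.
rewrite sinB; have := cos2Dsin2 a; have := cos2Dsin2 b.
move: (cos a) (sin a) (cos b) (sin b) => ca sa cb sb hb ha.
rewrite ler_norml; apply/andP; split.
  (* With u = (ca - 1, sa) and v = (cb - 1, - sb) as complex numbers, both
     bounds are |u|^2 + |v|^2 +- 2 Im (u v) >= 0, a sum of two squares. *)
  have h1 := sqr_ge0 (sa + (cb - 1)); have h2 := sqr_ge0 ((ca - 1) - sb).
  by nra.
have h1 := sqr_ge0 (sa - (cb - 1)); have h2 := sqr_ge0 ((ca - 1) + sb).
by nra.
Qed.

(** * The Fourier kernel *)

Section kernel.
Context {R : realType} {gamma : R} {c : {posnum R}}.
Hypothesis hc : stable_normalized gamma c.

Local Notation nu := (stable_measure gamma c).
Local Notation D := (~` [set (0 : R)])%classic.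

Let mD : measurable D.
Proof. exact: measurableC. Qed.

Let mcos (xi : R) : measurable_fun [set: R]%classic (fun z => 1 - cos (xi * z)).
Proof.
apply: measurable_funB => //; apply: measurableT_comp => //.
  by apply: continuous_measurable_fun; exact: continuous_cos.
Qed.

Let msin (xi : R) : measurable_fun [set: R]%classic (fun z => sin (xi * z)).
Proof.
apply: measurableT_comp => //.
  by apply: continuous_measurable_fun; exact: continuous_sin.
Qed.

Lemma integrable_1Bcos (xi : R) :
  nu.-integrable D (EFin \o (fun z => 1 - cos (xi * z))).
Proof.
apply/integrableP; split; first exact/measurable_EFinP/measurable_funTS.
rewrite (eq_integral (fun z => (1 - cos (xi * z))%:E)); last first.
  by move=> z _ /=; rewrite ger0_norm// subr_ge0 cos_le1.
by rewrite -hc ltry.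
Qed.

Lemma Rintegral_1Bcos (xi : R) :
  \int[nu]_(z in D) (1 - cos (xi * z)) = `|xi| `^ gamma.
Proof. by rewrite /Rintegral -hc. Qed.

Lemma integrable_Re_cexpi_incr (xi eta : R) :
  nu.-integrable D
    (EFin \o (fun z => complex.Re ((cexpi xi z - 1) * (cexpi eta z - 1)^*))).
Proof.
have i2 := integrableD mD (integrable_1Bcos xi) (integrable_1Bcos eta).
apply: eq_integrable (integrableB mD i2 (integrable_1Bcos (xi - eta))) => //.
by move=> z _; rewrite /comp Re_cexpi_incr.
Qed.

Lemma integrable_Im_cexpi_incr (xi eta : R) :
  nu.-integrable D
    (EFin \o (fun z => complex.Im ((cexpi xi z - 1) * (cexpi eta z - 1)^*))).
Proof.
apply: le_integrable
  (integrableD mD (integrable_1Bcos xi) (integrable_1Bcos eta)) => //.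
  apply/measurable_EFinP/measurable_funTS.
  under eq_fun do rewrite Im_cexpi_incr.
  by apply: measurable_funD => //; exact: measurable_funB.
move=> z _; rewrite /comp Im_cexpi_incr mulrBl /= lee_fin.
by apply: le_trans (ler_norm _); exact: sin_incr_le.
Qed.

Lemma cintegral_cexpi_incr (xi eta : R) :
  cintegral nu D (fun z => (cexpi xi z - 1) * (cexpi eta z - 1)^*) =
  (`|xi| `^ gamma + `|eta| `^ gamma - `|xi - eta| `^ gamma)%:C.
Proof.
rewrite /cintegral; congr (_ +i* _).
  under eq_Rintegral do rewrite Re_cexpi_incr.
  have i2 := integrableD mD (integrable_1Bcos xi) (integrable_1Bcos eta).
  rewrite (RintegralB mD i2 (integrable_1Bcos _)).
  by rewrite RintegralD ?Rintegral_1Bcos//; exact: integrable_1Bcos.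
apply: Rintegral_odd.
- exact: stable_measureN.
- exact: mD.
- apply/seteqP; split => z /= z0 z1; apply: z0; first by rewrite z1 oppr0.
  by rewrite -[z]opprK z1 oppr0.
- under eq_fun do rewrite Im_cexpi_incr.
  by apply: measurable_funD => //; exact: measurable_funB.
- exact: integrable_Im_cexpi_incr.
- by move=> z; rewrite !Im_cexpi_incr !mulrN !sinN; ring.
Qed.

(** The phase e^(i (xi - eta) x) factors out of the integrand. *)
Lemma carre_du_champ_cexpi (xi eta x : R) :
  carre_du_champ gamma c (cexpi xi) (cexpi eta) x =
  cexpi (xi - eta) x *
    (2^-1 * (`|xi| `^ gamma + `|eta| `^ gamma - `|xi - eta| `^ gamma))%:C.
Proof.
rewrite rmorphM/= -cintegral_cexpi_incr mulrCA -cintegralZl//.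
- rewrite /carre_du_champ; congr (_ * cintegral _ _ _); apply/funext => z.
  by rewrite cexpiB !cexpiD !rmorphB !rmorphM/= rmorph1; ring.
- exact: integrable_Re_cexpi_incr.
- exact: integrable_Im_cexpi_incr.
Qed.

Lemma fourier_kernelE (xi eta : R) :
  fourier_kernel gamma c xi eta =
  (2^-1 * (`|xi| `^ gamma + `|eta| `^ gamma - `|xi - eta| `^ gamma))%:C.
Proof.
apply: xget_unique => [x | w /(_ 0)]; first exact: carre_du_champ_cexpi.
have -> : cexpi (xi - eta) 0 = 1 by rewrite /cexpi mulr0 cos0 sin0.
by rewrite carre_du_champ_cexpi /cexpi mulr0 cos0 sin0 !mul1r.
Qed.

End kernel.

(** * Comparison with the covariance of fractional Brownian motion *)

Lemma fbm_cov_norm (R : realType) (gamma xi eta : R) :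
  fbm_cov (gamma / 2) `|xi| `|eta| =
  2^-1 * (`|xi| `^ gamma + `|eta| `^ gamma - `| `|xi| - `|eta| | `^ gamma).
Proof. by rewrite /fbm_cov !normr_id (mulrC 2) divfK ?pnatr_eq0. Qed.

Lemma dist_norm_same_sign (R : realType) (xi eta : R) :
  0 <= xi * eta -> `| `|xi| - `|eta| | = `|xi - eta|.
Proof.
have [xi0|xi0|->] := ltrgt0P xi; last by rewrite !sub0r !normrN normr_id.
  by rewrite pmulr_rge0// => eta0; rewrite (ger0_norm eta0).
by rewrite nmulr_rge0// => eta0; rewrite (ler0_norm eta0) opprK addrC distrC.
Qed.

(** The squares of the two sides differ by 2 (|xi eta| - xi eta) =
    - 4 xi eta. *)
Lemma dist_norm_opp_sign (R : realType) (xi eta : R) :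
  xi * eta < 0 -> `| `|xi| - `|eta| | < `|xi - eta|.
Proof.
move=> xe0; rewrite -ltr_sqr ?nnegrE// !real_normK ?num_real//.
have h := normrM xi eta; rewrite (ltr0_norm xe0) in h.
have h1 := real_normK (num_real xi); have h2 := real_normK (num_real eta).
by nra.
Qed.

Theorem theorem3p1 (R : realType) (gamma : R) (hgamma : 0 < gamma < 2)
    (c : {posnum R}) (hc : stable_normalized gamma c) :
  (forall xi eta : R, 0 <= xi * eta ->
     fourier_kernel gamma c xi eta =
       (2^-1 * (`|xi| `^ gamma + `|eta| `^ gamma - `|xi - eta| `^ gamma))%:C /\
     2^-1 * (`|xi| `^ gamma + `|eta| `^ gamma - `|xi - eta| `^ gamma) =
       fbm_cov (gamma / 2) `|xi| `|eta|) /\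
  (forall xi eta : R, xi * eta < 0 ->
     [/\ fourier_kernel gamma c xi eta =
           (2^-1 * (`|xi| `^ gamma + `|eta| `^ gamma
                    - `|xi - eta| `^ gamma))%:C,
         fbm_cov (gamma / 2) `|xi| `|eta| =
           2^-1 * (`|xi| `^ gamma + `|eta| `^ gamma
                   - `| `|xi| - `|eta| | `^ gamma)
       & fourier_kernel gamma c xi eta <>
           (fbm_cov (gamma / 2) `|xi| `|eta|)%:C]).
Proof.
have [gamma0 _] := andP hgamma.
split=> xi eta xe.
  by rewrite fbm_cov_norm dist_norm_same_sign// fourier_kernelE.
split; [exact: fourier_kernelE | exact: fbm_cov_norm |].
rewrite fourier_kernelE// fbm_cov_norm => /complexI; apply/eqP.
rewrite lt_eqF// ltr_pM2l ?invr_gt0// ltrD2l ltrN2.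
by apply: gt0_ltr_powR; rewrite ?nnegrE//; exact: dist_norm_opp_sign.
Qed.
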